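(* Let $\theta$ be a non-constant inner function and let $T$ be a bounded operator on $\mathcal{K}_\theta$. If $T=A+B=A'+B'$ with $A,A'\in\mathcal{T}_\theta$ and $B,B'\in\mathcal{H}_\theta$, then $$A-A'=B'-B\in\mathcal{I}_\theta,\qquad \mathcal{I}_\theta=\mathcal{T}_\theta\cap\mathcal{H}_\theta.$$ Conversely, if $C\in\mathcal{I}_\theta$ and $T=A+B$ with $A\in\mathcal{T}_\theta$ and $B\in\mathcal{H}_\theta$, then $T=(A+C)+(B-C)$ is again a decomposition of $T$ as a sum of a truncated Toeplitz operator and a truncated Hankel operator (i.e. $A+C\in\mathcal{T}_\theta$, $B-C\in\mathcal{H}_\theta$). Hence the decomposition is unique modulo $\mathcal{I}_\theta$.
   Context: $\mathbb{T}$ is the unit circle with normalized Lebesgue measure, $L^2=L^2(\mathbb{T})$, $H^2\subset L^2$ is the Hardy space, $H^2_-=L^2\ominus H^2$, and $P_{H^2_-}$ is the orthogonal projection onto $H^2_-$. An inner function $\theta$ is a bounded analytic function on the unit disk with $|\theta|=1$ a.e. on $\mathbb{T}$. The model space is $\mathcal{K}_\theta=H^2\ominus\theta H^2$ and $P_{\mathcal{K}_\theta}:L^2\to\mathcal{K}_\theta$ is the orthogonal projection. For $\varphi\in L^\infty(\mathbb{T})$ the truncated Toeplitz operator is $A_\varphi f=P_{\mathcal{K}_\theta}(\varphi f)$, $f\in\mathcal{K}_\theta$, and the truncated Hankel operator is $B_\varphi f=P_{\mathcal{K}_\theta}JP_{H^2_-}(\varphi f)$, $f\in\mathcal{K}_\theta$,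 where $J:L^2\to L^2$ is the unitary $(Jf)(z)=\bar z f(\bar z)$. $\mathcal{T}_\theta$ and $\mathcal{H}_\theta$ are the sets of all truncated Toeplitz and all truncated Hankel operators on $\mathcal{K}_\theta$, respectively. *)

(* Defs.v *)
From HB Require Import structures.
From mathcomp Require Import all_boot all_order all_algebra.
From mathcomp Require Import complex.
From mathcomp Require Import all_classical all_reals all_analysis.
From mathcomp Require Import ess_sup_inf measurable_realfun.

Set Implicit Arguments.
Unset Strict Implicit.
Unset Printing Implicit Defensive.
Import Order.TTheory GRing.Theory Num.Theory.
Import numFieldNormedType.Exports.

Local Open Scope classical_set_scope.
Local Open Scope complex_scope.
Local Open Scope ring_scope.

Section circle.
Context (R : realType).

Record circle := Circle { circle_val :> R[i]; _ : `|circle_val| == 1 }.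

HB.instance Definition _ := [isSub for circle_val].
HB.instance Definition _ := [Choice of circle by <:].

Fact normr1_circle : `|1 : R[i]| == 1. Proof. by rewrite normr1. Qed.

HB.instance Definition _ := isPointed.Build circle (Circle normr1_circle).

Fact expi_subproof (t : R) : `|cos t +i* sin t : R[i]| == 1.
Proof. by rewrite normc_def /= cos2Dsin2 sqrtr1. Qed.

Definition expi (t : R) : circle := Circle (expi_subproof t).

Fact conj_circle_subproof (z : circle) : `|(z : R[i])^*%C| == 1.
Proof. by rewrite normcJ (valP z). Qed.

Definition conj_circle (z : circle) : circle := Circle (conj_circle_subproof z).

(* The final sigma-algebra along t |-> e^{it}; since that map is a Borel
   isomorphism from ]-pi, pi] onto the circle, this is the Borel sigma-algebra. *)
Definition circle_measurable : set (set circle) :=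
  [set A | measurable (expi @^-1` A : set (measurableTypeR R))].

Fact circle_measurable0 : circle_measurable set0.
Proof. by rewrite /circle_measurable /= preimage_set0. Qed.

Fact circle_measurableC A :
  circle_measurable A -> circle_measurable (~` A).
Proof. by rewrite /circle_measurable /= preimage_setC; exact: measurableC. Qed.

Fact circle_measurable_bigcup (F : (set circle)^nat) :
  (forall n, circle_measurable (F n)) -> circle_measurable (\bigcup_n F n).
Proof.
by move=> mF; rewrite /circle_measurable /= preimage_bigcup;
apply: bigcup_measurable => n _; exact: mF.
Qed.

Definition circle_display : measure_display. Proof. by constructor. Qed.

HB.instance Definition _ := @isMeasurable.Build circle_display circle
  circle_measurable circle_measurable0 circle_measurableC circle_measurable_bigcup.

Lemma measurable_expi :
  measurable_fun [set: measurableTypeR R] (expi : measurableTypeR R -> circle).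
Proof. by move=> _ A mA; rewrite setTI. Qed.
HB.instance Definition _ := isMeasurableFun.Build _ _ _ _ (expi : measurableTypeR R -> circle) measurable_expi.

End circle.

Section circle_measure.
Context (R : realType).

Fact ltNpipi : - pi < pi :> R.
Proof. by rewrite -subr_gt0 opprK addr_gt0 // pi_gt0. Qed.

(* Normalized Lebesgue measure: the image under t |-> e^{it} of the uniform
   probability on [-pi, pi], i.e. of dt / (2 pi). *)
Definition circle_measure : set (circle R) -> \bar R :=
  distribution (uniform_prob ltNpipi) (@expi R).

HB.instance Definition _ := Probability.on circle_measure.
End circle_measure.
Arguments circle_measure : clear implicits.

Section real_Lp.
Context (R : realType).
Local Notation m := (circle_measure R).

Lemma circle_measureT_gt0 : (0 < m [set: circle R])%E.
Proof. by rewrite probability_setT lte01. Qed.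

Lemma Lfun_bounded (u : circle R -> R) (M : R) :
  measurable_fun setT u -> (forall z, `|u z| <= M) -> u \in Lfun m +oo%E.
Proof.
move=> mu uM; rewrite inE; apply/andP; split; rewrite inE //=.
rewrite /finite_norm unlock /Lnorm circle_measureT_gt0.
apply: (@le_lt_trans _ _ M%:E); last by rewrite ltry.
by apply/ess_supP; apply: nearW => z /=; rewrite lee_fin.
Qed.

Lemma Lfunoo_ae_bounded (u : circle R -> R) : u \in Lfun m +oo%E ->
  measurable_fun setT u /\ exists M, \forall z \ae m, `|u z| <= M.
Proof.
rewrite inE => /andP[/[!inE] /= mu]; rewrite /finite_norm unlock /Lnorm.
rewrite circle_measureT_gt0 => uoo; split => //.
exact: (@ess_supr_bounded _ _ _ m (fun z => `|u z|)).
Qed.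

Lemma Lfun2P (u : circle R -> R) :
  u \in Lfun m 2%:E <->
  measurable_fun setT u /\ (\int[m]_z (u z ^+ 2)%:E < +oo)%E.
Proof.
split=> [u2|[mu iu]].
  have /integrableP[_] := Lfun2_integrable_sqr u2.
  move: u2; rewrite inE => /andP[/[!inE] /= mu _] h; split => //.
  apply: le_lt_trans h; rewrite le_eqVlt; apply/orP; left; apply/eqP.
  by apply: eq_integral => z _; rewrite /= ger0_norm// sqr_ge0.
rewrite inE; apply/andP; split; rewrite inE //=.
rewrite /finite_norm unlock /Lnorm; apply: poweR_lty.
rewrite (le_lt_trans _ iu)// le_eqVlt; apply/orP; left; apply/eqP.
by apply: eq_integral => z _; rewrite /= powR_mulrn// real_normK ?num_real.
Qed.

Lemma Lfun_mul (u v : circle R -> R) :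
  u \in Lfun m +oo%E -> v \in Lfun m 2%:E -> u \* v \in Lfun m 2%:E.
Proof.
move=> /Lfunoo_ae_bounded[mu [M uM]] /Lfun2P[mv iv]; apply/Lfun2P.
split; first exact: measurable_funM.
have mv2 : measurable_fun setT (fun z => (v z ^+ 2)%:E).
  by apply/measurable_EFinP; exact: measurable_funX.
apply: (@le_lt_trans _ _ (\int[m]_z ((M ^+ 2)%:E * (v z ^+ 2)%:E))%E).
  apply: ae_ge0_le_integral => //.
  - by move=> z _; rewrite lee_fin sqr_ge0.
  - apply/measurable_EFinP; apply: measurable_funX; exact: measurable_funM.
  - by move=> z _; rewrite -EFinM lee_fin mulr_ge0// sqr_ge0.
  - exact: measurable_funeM.
  - apply: filterS uM => z uM _; rewrite -EFinM lee_fin exprMn ler_wpM2r ?sqr_ge0//.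
    rewrite -real_normK ?num_real// lerXn2r ?nnegrE//.
    exact: le_trans uM.
rewrite ge0_integralZl//; last 2 first.
  - by move=> z _; rewrite lee_fin sqr_ge0.
  - by rewrite lee_fin sqr_ge0.
by rewrite lte_mul_pinfty// lee_fin sqr_ge0.
Qed.

Lemma measurable_conj_circle :
  measurable_fun setT (@conj_circle R).
Proof.
have h : measurable_fun [set: measurableTypeR R]
    ((@expi R) \o (-%R : measurableTypeR R -> measurableTypeR R)).
  have mo : measurable_fun [set: measurableTypeR R]
    (-%R : measurableTypeR R -> measurableTypeR R) by exact: oppr_measurable.
  have := mo; have := @measurable_expi R; exact: measurableT_comp.
have E : (@expi R) \o -%R = @conj_circle R \o @expi R.
  by apply/funext => t; apply/val_inj => /=; rewrite cosN sinN.
move: h; rewrite E => h _ A mA; rewrite setTI.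
by have := h measurableT A mA; rewrite setTI comp_preimage.
Qed.

Lemma integral_conj_circle (f : circle R -> \bar R) :
  measurable_fun setT f -> (forall z, 0 <= f z)%E ->
  (\int[m]_z f (conj_circle z) = \int[m]_z f z)%E.
Proof.
move=> mf f0.
have mfe : measurable_fun [set: measurableTypeR R] (f \o @expi R).
  have := @measurable_expi R; have := mf; exact: measurableT_comp.
have mfc : measurable_fun setT (f \o @conj_circle R).
  exact: (measurableT_comp mf measurable_conj_circle).
have mfce : measurable_fun [set: measurableTypeR R] ((f \o @conj_circle R) \o @expi R).
  have := @measurable_expi R; have := mfc; exact: measurableT_comp.
rewrite /circle_measure.
rewrite (@ge0_integral_distribution _ _ _ _ _ _ (@expi R) f)//.
rewrite (@ge0_integral_distribution _ _ _ _ _ _ (@expi R) (f \o @conj_circle R))//; last first.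
  by move=> z; exact: f0.
rewrite !integral_uniform//=.
congr (_ * _)%E.
have -> : (fun x : R => f (conj_circle (expi x))) = (fun x => (f \o @expi R) (- x)).
  apply/funext => t /=; congr f.
  by apply/val_inj => /=; rewrite cosN sinN.
rewrite [RHS](_ : _ = \int[pushforward lebesgue_measure (-%R : measurableTypeR R -> measurableTypeR R)]_(x in `[(- pi)%R, pi]) (f \o @expi R) x)%E; last first.
  by apply: eq_measure_integral => //= A mA AS; exact/esym/lebesgue_measureN.
rewrite ge0_integral_pushforward//=; last exact: measurable_funTS.
by rewrite opp_preimage_itvbndbnd /= opprK.
Qed.

Lemma Lfun_conj (u : circle R -> R) :
  u \in Lfun m 2%:E -> u \o @conj_circle R \in Lfun m 2%:E.
Proof.
move=> /Lfun2P[mu iu]; apply/Lfun2P; split.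
  by have := measurable_conj_circle; have := mu; exact: measurableT_comp.
rewrite (integral_conj_circle (f := fun z => (u z ^+ 2)%:E))//.
  by apply/measurable_EFinP; exact: measurable_funX.
by move=> z; rewrite lee_fin sqr_ge0.
Qed.

Lemma ae_conj_circle (P : circle R -> Prop) :
  (\forall z \ae m, P z) -> \forall z \ae m, P (conj_circle z).
Proof.
move=> [N [mN N0 PN]]; exists (@conj_circle R @^-1` N).
have mcN : measurable (@conj_circle R @^-1` N).
  by rewrite -[X in measurable X]setTI; exact: measurable_conj_circle.
split => //; last by move=> z; exact: PN.
have E := integral_conj_circle (f := fun z => (\1_N z)%:E).
have -> : m (@conj_circle R @^-1` N) = (\int[m]_z (\1_N (conj_circle z))%:E)%E.
  rewrite -(setIT (_ @^-1` N)) -integral_indic//.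
rewrite E ?integral_indic ?setIT//.
  by apply/measurable_EFinP; exact: measurable_indic.
Qed.

End real_Lp.

Section complex_Lp.
Context (R : realType).
Local Notation m := (circle_measure R).
Local Notation C := R[i].
Local Notation Re := (@complex.Re (Real.sort R)).
Local Notation Im := (@complex.Im (Real.sort R)).

(* Complex L^p functions: |f| has finite L^p norm iff Re f and Im f do. *)
Definition cLfun (p : \bar R) : {pred circle R -> C} :=
  [pred f | (Re \o f \in Lfun m p) && (Im \o f \in Lfun m p)].

Lemma Lfun_lin p (p1 : (1 <= p)%E) a b (u v w : circle R -> R) :
  u \in Lfun m p -> v \in Lfun m p -> w \in Lfun m p ->
  (fun z => a * u z + b * v z + w z) \in Lfun m p.
Proof.
move=> u2 v2 w2; have [_ c] := @Lfun_submod_closed _ _ _ m _ p1.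
have -> : (fun z => a * u z + b * v z + w z) = a *: u + (b *: v + w).
  by apply/funext => z; rewrite !fctE /= addrA.
exact/c/c.
Qed.

Lemma Lfun0 p (p1 : (1 <= p)%E) : (cst 0 : circle R -> R) \in Lfun m p.
Proof. by have [] := @Lfun_submod_closed _ _ _ m _ p1. Qed.

Lemma cLfun_submod_closed p : (1 <= p)%E -> submod_closed (cLfun p).
Proof.
move=> p1; split.
  by apply/andP; split; exact: Lfun0.
move=> a f g /andP[f1 f2] /andP[g1 g2]; apply/andP; split.
  have -> : Re \o (a *: f + g) =
      (fun z => Re a * Re (f z) + (- Im a) * Im (f z) + Re (g z)).
    apply/funext => z /=; rewrite !fctE /=; case: a (f z) (g z) => [? ?] [? ?] [? ?] /=.
    by rewrite mulNr.
  exact: (Lfun_lin p1 _ _ f1 f2 g1).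
have -> : Im \o (a *: f + g) =
      (fun z => Im a * Re (f z) + Re a * Im (f z) + Im (g z)).
  apply/funext => z /=; rewrite !fctE /=; case: a (f z) (g z) => [? ?] [? ?] [? ?] /=.
  by congr (_ + _); rewrite addrC.
exact: (Lfun_lin p1 _ _ f1 f2 g2).
Qed.

Lemma le12 : (1 <= 2%:E :> \bar R)%E. Proof. by rewrite lee_fin ler1n. Qed.

Definition L2fun : {pred circle R -> C} := cLfun 2%:E.

HB.instance Definition _ := GRing.isSubmodClosed.Build C (circle R -> C) L2fun
  (cLfun_submod_closed le12).

Record sqint := Sqint { sqint_val :> circle R -> C; _ : sqint_val \in L2fun }.
HB.instance Definition _ := [isSub for sqint_val].
HB.instance Definition _ := [Choice of sqint by <:].
HB.instance Definition _ := [SubChoice_isSubLmodule of sqint by <:].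

Definition aezero : {pred sqint} :=
  [pred f : sqint | `[< \forall z \ae m, f z = 0 >]].

Lemma aezeroP (f : sqint) : reflect (\forall z \ae m, f z = 0) (f \in aezero).
Proof. exact: asboolP. Qed.

Lemma aezero_submod_closed : submod_closed aezero.
Proof.
split; first by apply/aezeroP; apply: nearW => z.
move=> a f g /aezeroP f0 /aezeroP g0; apply/aezeroP.
apply: filterS2 f0 g0 => z /= fz gz.
by rewrite /= !fctE /= fz gz scaler0 addr0.
Qed.
HB.instance Definition _ := GRing.isSubmodClosed.Build C sqint aezero
  aezero_submod_closed.

(* L^2 modulo almost everywhere equality; the scalar field is R[i]. *)
Definition L2 := {ideal_quot aezero}.
HB.instance Definition _ := Choice.on L2.
HB.instance Definition _ := GRing.Zmodule.on L2.
HB.instance Definition _ := EqQuotient.on L2.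
Local Open Scope quotient_scope.

Lemma L2_eqP (f g : sqint) :
  \pi_L2 f = \pi_L2 g <-> \forall z \ae m, f z = g z.
Proof.
split.
  move=> /eqP; rewrite -Quotient.idealrBE => /aezeroP; apply: filterS => z /=.
  by move=> /eqP; rewrite !fctE subr_eq0 => /eqP.
move=> fg; apply/eqP; rewrite -Quotient.idealrBE; apply/aezeroP.
by apply: filterS fg => z fgz; rewrite /= !fctE fgz subrr.
Qed.

Definition L2_scale (a : C) (f : L2) : L2 := \pi_L2 (a *: repr f).

Lemma pi_L2_scale a (f : sqint) : L2_scale a (\pi_L2 f) = \pi_L2 (a *: f).
Proof.
apply/L2_eqP; have /L2_eqP : \pi_L2 (repr (\pi_L2 f)) = \pi_L2 f by rewrite reprK.
by apply: filterS => z fz; rewrite /= !fctE fz.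
Qed.

Fact L2_scaleA a b (f : L2) : L2_scale a (L2_scale b f) = L2_scale (a * b) f.
Proof.
by elim/quotW: f => f; rewrite (pi_L2_scale b f) (pi_L2_scale a) (pi_L2_scale _ f) scalerA.
Qed.

Fact L2_scale1 : left_id 1 L2_scale.
Proof. by elim/quotW => f; rewrite (pi_L2_scale 1 f) scale1r. Qed.

Fact L2_scaleDr : right_distributive L2_scale +%R.
Proof.
move=> a; elim/quotW => f; elim/quotW => g.
by rewrite -raddfD (pi_L2_scale a f) (pi_L2_scale a g) (pi_L2_scale a (f + g)) -raddfD scalerDr.
Qed.

Fact L2_scaleDl f : {morph L2_scale^~ f : a b / a + b}.
Proof. by move=> a b /=; rewrite /L2_scale -raddfD scalerDl. Qed.

HB.instance Definition _ := GRing.Zmodule_isLmodule.Build C L2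
  L2_scaleA L2_scale1 L2_scaleDr L2_scaleDl.
End complex_Lp.
Arguments L2fun : clear implicits.

Section complex_functions.
Context (R : realType).
Local Notation m := (circle_measure R).
Local Notation C := R[i].
Local Notation Re := (@complex.Re (Real.sort R)).
Local Notation Im := (@complex.Im (Real.sort R)).

Lemma measurable_circleP (u : circle R -> R) :
  measurable_fun [set: measurableTypeR R] (u \o @expi R) -> measurable_fun setT u.
Proof.
by move=> mu _ A mA; rewrite setTI; have := mu measurableT A mA; rewrite setTI.
Qed.

Lemma circle_norm (z : circle R) : `|z : C| = 1.
Proof. exact/eqP/(valP z). Qed.

Lemma ReM_fun (f g : circle R -> C) :
  (fun z => Re (f z * g z)) =
  (fun z => 1 * (Re (f z) * Re (g z)) + (- 1) * (Im (f z) * Im (g z)) + 0).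
Proof.
by apply/funext => z; case: (f z) (g z) => [? ?] [? ?] /=; rewrite mul1r mulN1r addr0.
Qed.

Lemma ImM_fun (f g : circle R -> C) :
  (fun z => Im (f z * g z)) =
  (fun z => 1 * (Re (f z) * Im (g z)) + 1 * (Im (f z) * Re (g z)) + 0).
Proof.
by apply/funext => z; case: (f z) (g z) => [? ?] [? ?] /=; rewrite !mul1r addr0.
Qed.

Lemma cLfun_mul_L2 (f g : circle R -> C) : f \in cLfun +oo%E -> g \in L2fun R ->
  (fun z => f z * g z) \in L2fun R.
Proof.
move=> /andP[f1 f2] /andP[g1 g2]; have z0 := Lfun0 (@le12 R); apply/andP; split.
  by rewrite /comp ReM_fun; apply: (Lfun_lin (@le12 R)) => //; exact: Lfun_mul.
by rewrite /comp ImM_fun; apply: (Lfun_lin (@le12 R)) => //; exact: Lfun_mul.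
Qed.

Lemma L2fun_mul_L1 (f g : circle R -> C) : f \in L2fun R -> g \in L2fun R ->
  (fun z => f z * g z) \in cLfun 1.
Proof.
move=> /andP[f1 f2] /andP[g1 g2]; have z0 := Lfun0 (@lexx _ _ 1%E); apply/andP; split.
  by rewrite /comp ReM_fun; apply: (Lfun_lin (@lexx _ _ 1%E)) => //; exact: Lfun2_mul_Lfun1.
by rewrite /comp ImM_fun; apply: (Lfun_lin (@lexx _ _ 1%E)) => //; exact: Lfun2_mul_Lfun1.
Qed.

Lemma L2fun_conj (f : circle R -> C) : f \in L2fun R -> (fun z => (f z)^*) \in L2fun R.
Proof.
move=> /andP[f1 f2]; have z0 := Lfun0 (@le12 R); apply/andP; split.
  by rewrite (_ : Re \o _ = Re \o f)//; apply/funext => z /=; case: (f z).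
rewrite (_ : Im \o _ = (fun z => (-1) * Im (f z) + 0 * 0 + 0)).
  exact: (Lfun_lin (@le12 R) _ _ f2 z0 z0).
by apply/funext => z /=; case: (f z) => a b /=; rewrite mul0r !addr0 mulN1r.
Qed.

Lemma cLfun_bounded (f : circle R -> C) (M : R) :
  measurable_fun setT (Re \o f) -> measurable_fun setT (Im \o f) ->
  (forall z, `|f z| <= M%:C) -> f \in cLfun +oo%E.
Proof.
move=> m1 m2 fM; apply/andP; split; apply: (@Lfun_bounded _ _ M) => // z.
  by rewrite -lecR (le_trans _ (fM z))//; exact: normc_ge_Re.
rewrite -lecR (le_trans _ (fM z))//= -(normrN (Im _)) -ReiNIm.
by rewrite (le_trans (normc_ge_Re _))// normrM (normc_def 'i%C) /= expr0n expr1n add0r sqrtr1 mulr1.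
Qed.

Lemma measurable_circle_expn (n : nat) :
  measurable_fun setT (fun z : circle R => Re ((z : C) ^+ n)) /\
  measurable_fun setT (fun z : circle R => Im ((z : C) ^+ n)).
Proof.
have m1 : measurable_fun setT (fun z : circle R => Re z).
  by apply: measurable_circleP; apply: continuous_measurable_fun; exact: continuous_cos.
have m2 : measurable_fun setT (fun z : circle R => Im z).
  by apply: measurable_circleP; apply: continuous_measurable_fun; exact: continuous_sin.
elim: n => [|n [ih1 ih2]]; first by split; exact: measurable_cst.
split.
  rewrite (_ : (fun _ => _) =
    (fun z : circle R => Re z * Re ((z : C) ^+ n) - Im z * Im ((z : C) ^+ n))).
    by apply: measurable_funB; exact: measurable_funM.
  by apply/funext => z; rewrite exprS; case: (circle_val z) (_ ^+ n) => [? ?] [? ?].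
rewrite (_ : (fun _ => _) =
  (fun z : circle R => Re z * Im ((z : C) ^+ n) + Im z * Re ((z : C) ^+ n))).
  by apply: measurable_funD; exact: measurable_funM.
by apply/funext => z; rewrite exprS; case: (circle_val z) (_ ^+ n) => [? ?] [? ?].
Qed.

Lemma circle_inv (z : circle R) (n : nat) : ((z : C) ^+ n)^-1 = ((z : C) ^+ n)^*.
Proof. by rewrite invc_norm normrX circle_norm !expr1n invr1 mul1r. Qed.

Lemma cLfun_monomial (n : int) : (fun z : circle R => (z : C) ^ n) \in cLfun +oo%E.
Proof.
have nz (k : int) (z : circle R) : `|(z : C) ^ k| <= (1 : R)%:C.
  by case: k => k; rewrite /exprz ?normfV normrX circle_norm expr1n ?invr1.
apply: cLfun_bounded (nz n); case: n => n.
- exact: (measurable_circle_expn n).1.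
- rewrite (_ : Re \o _ = fun z : circle R => Re ((z : C) ^+ n.+1)).
    exact: (measurable_circle_expn _).1.
  by apply/funext => z; rewrite /= /exprz circle_inv; case: (_ ^+ _).
- exact: (measurable_circle_expn n).2.
- rewrite (_ : Im \o _ = fun z : circle R => - Im ((z : C) ^+ n.+1)).
    by apply: measurable_funN; exact: (measurable_circle_expn _).2.
  by apply/funext => z; rewrite /= /exprz circle_inv; case: (_ ^+ _).
Qed.

Lemma L2fun_monomial (n : int) : (fun z : circle R => (z : C) ^ n) \in L2fun R.
Proof.
rewrite (_ : (fun _ => _) = fun z : circle R => (z : C) ^ n * cst 1 z).
  apply: cLfun_mul_L2; first exact: cLfun_monomial.
  by apply/andP; split; exact: Lfun_cst.
by apply/funext => z; rewrite mulr1.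
Qed.

Definition cint (f : circle R -> C) : C :=
  (\int[m]_z Re (f z)) +i* (\int[m]_z Im (f z)).

Lemma cint_linear a (f g : circle R -> C) : f \in cLfun 1 -> g \in cLfun 1 ->
  cint (fun z => a * f z + g z) = a * cint f + cint g.
Proof.
move=> /andP[/Lfun1_integrable f1 /Lfun1_integrable f2].
move=> /andP[/Lfun1_integrable g1 /Lfun1_integrable g2].
have iZ b (u : circle R -> R) : m.-integrable setT (EFin \o u) ->
    m.-integrable setT (EFin \o (fun z => b * u z)).
  move=> iu; rewrite (_ : EFin \o _ = fun z => (b%:E * (EFin \o u) z)%E)//.
  exact: integrableZl.
have L (b c : R) (u v w : circle R -> R) : m.-integrable setT (EFin \o u) ->
   m.-integrable setT (EFin \o v) -> m.-integrable setT (EFin \o w) ->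
   (\int[m]_z (b * u z + c * v z + w z) =
    b * \int[m]_z u z + c * \int[m]_z v z + \int[m]_z w z).
  move=> iu iv iw; rewrite RintegralD//; last first.
    rewrite (_ : EFin \o _ = ((EFin \o (fun z => b * u z)%R) \+ (EFin \o (fun z => c * v z)%R))%E)//.
    by apply: integrableD => //; exact: iZ.
  by rewrite RintegralD ?RintegralZl//; exact: iZ.
rewrite /cint; case: a => a b; apply/eqP; rewrite eq_complex /=; apply/andP; split; apply/eqP.
  rewrite -mulNr -L//; apply: eq_Rintegral => z _.
  by case: (f z) (g z) => [? ?] [? ?] /=; rewrite mulNr.
rewrite -L//; apply: eq_Rintegral => z _.
by case: (f z) (g z) => [? ?] [? ?] /=.
Qed.

Lemma ae_eq_cint (f g : circle R -> C) : f \in cLfun 1 -> g \in cLfun 1 ->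
  (\forall z \ae m, f z = g z) -> cint f = cint g.
Proof.
move=> /andP[/Lfun1_integrable/measurable_int f1 /Lfun1_integrable/measurable_int f2].
move=> /andP[/Lfun1_integrable/measurable_int g1 /Lfun1_integrable/measurable_int g2] fg.
by rewrite /cint /Rintegral; congr (fine _ +i* fine _); apply: ae_eq_integral => //;
  apply: filterS fg => z /= ->.
Qed.

End complex_functions.

Section L2_space.
Context (R : realType).
Local Notation m := (circle_measure R).
Local Notation C := R[i].
Local Open Scope quotient_scope.

Definition L2_repr (f : L2 R) : sqint R := repr f.
Definition L2_fun (f : L2 R) : circle R -> C := L2_repr f.
Coercion L2_fun : L2 >-> Funclass.

Lemma L2_funP (f : L2 R) : (f : circle R -> C) \in L2fun R.
Proof. exact: valP (L2_repr f). Qed.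

Definition L2_class (f : circle R -> C) (f2 : f \in L2fun R) : L2 R :=
  \pi_(L2 R) (Sqint f2).

Lemma L2_classE (f : circle R -> C) (f2 : f \in L2fun R) :
  \forall z \ae m, L2_class f2 z = f z.
Proof. by apply/(L2_eqP (repr (\pi_(L2 R) (Sqint f2))) (Sqint f2)); rewrite reprK. Qed.

Lemma L2_ext (f g : L2 R) : (\forall z \ae m, f z = g z) -> f = g.
Proof. by rewrite -[f]reprK -[g]reprK => fg; apply/L2_eqP; rewrite !reprK in fg. Qed.

Lemma L2_linE a (f g : L2 R) : \forall z \ae m, L2_fun (a *: f + g) z = a * f z + g z.
Proof.
apply/(L2_eqP (repr (a *: f + g)) (a *: repr f + repr g)).
rewrite reprK.
have -> : \pi_(L2 R) (a *: repr f + repr g) = \pi_(L2 R) (a *: repr f) + \pi_(L2 R) (repr g).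
  exact: raddfD.
by rewrite (reprK g).
Qed.

Definition dotL2 (f g : L2 R) : C := cint (fun z => f z * (g z)^*).

Definition normL2 (f : L2 R) : R := Num.sqrt (complex.Re (dotL2 f f)).

Definition fourier (f : L2 R) (n : int) : C := cint (fun z => f z * (z : C) ^ (- n)).

Lemma cint_linL2 a (f g : L2 R) (h : circle R -> C) : h \in L2fun R ->
  cint (fun z => L2_fun (a *: f + g) z * h z) =
  a * cint (fun z => f z * h z) + cint (fun z => g z * h z).
Proof.
move=> h2; have fh := L2fun_mul_L1 (L2_funP f) h2; have gh := L2fun_mul_L1 (L2_funP g) h2.
have lin := @cLfun_submod_closed R _ (@lexx _ _ 1%E).
rewrite -cint_linear//; apply: ae_eq_cint.
- exact: L2fun_mul_L1 (L2_funP _) h2.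
- by have [_ c] := lin; exact: (c a _ _ fh gh).
- by apply: filterS (L2_linE a f g) => z ->; rewrite mulrDl mulrA.
Qed.

Lemma dotL2_linear a (f g h : L2 R) : dotL2 (a *: f + g) h = a * dotL2 f h + dotL2 g h.
Proof. by apply: cint_linL2; apply: L2fun_conj; exact: L2_funP. Qed.

Lemma fourier_linear a (f g : L2 R) n : fourier (a *: f + g) n = a * fourier f n + fourier g n.
Proof. by apply: cint_linL2; exact: L2fun_monomial. Qed.

(* H^2 as a subspace of L^2: the negative Fourier coefficients vanish. *)
Definition hardy : set (L2 R) := [set f | forall n : int, n < 0 -> fourier f n = 0].

Definition orth (S : set (L2 R)) : set (L2 R) := [set f | forall g, S g -> dotL2 f g = 0].

Definition hardy_minus : set (L2 R) := orth hardy.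

(* g is the orthogonal projection of f onto M; g is unique when M is a
   subspace (orthoproj_uniq), and exists when M is closed. *)
Definition is_orthoproj (M : set (L2 R)) (f g : L2 R) : Prop := M g /\ orth M (f - g).

Lemma dotL2_eq0 (f : L2 R) : dotL2 f f = 0 -> f = 0.
Proof.
rewrite /dotL2 /cint => /eqP; rewrite eq_complex /= => /andP[/eqP f0 _].
have /andP[/Lfun1_integrable If _] := L2fun_mul_L1 (L2_funP f) (L2fun_conj (L2_funP f)).
have sq z : complex.Re (f z * (f z)^*) = complex.Re (f z) ^+ 2 + complex.Im (f z) ^+ 2.
  by case: (f z) => a b /=; rewrite mulrN opprK !expr2.
have sq0 z : 0 <= complex.Re (f z * (f z)^*) by rewrite sq addr_ge0 ?sqr_ge0.
have If0 : (\int[m]_z `|(complex.Re (f z * (f z)^*))%:E| = 0)%E.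
  under eq_integral do rewrite gee0_abs ?lee_fin//.
  by rewrite -(@fineK _ (integral _ _ _)) ?integrable_fin_num// [fine _]f0.
have /(ae_eq_integral_abs m measurableT (measurable_int _ If)) := If0.
move=> ae0; apply: L2_ext.
have : \forall z \ae m, L2_fun 0 z = 0.
  have := L2_linE (-1) 0 0; rewrite scaleN1r addNr; apply: filterS => z.
  by rewrite mulN1r addNr.
apply: filterS2 ae0 => z /(_ I) /= [] + ->; rewrite sq.
case: (f z) => a b /= /eqP; rewrite paddr_eq0 ?sqr_ge0// !sqrf_eq0.
by move=> /andP[/eqP-> /eqP->].
Qed.

Lemma orthoproj_uniq (M : set (L2 R)) (f g g' : L2 R) :
  (forall u v, M u -> M v -> M (u - v)) ->
  is_orthoproj M f g -> is_orthoproj M f g' -> g = g'.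
Proof.
move=> MB [Mg og] [Mg' og']; apply/eqP; rewrite -subr_eq0; apply/eqP/dotL2_eq0.
have E : g - g' = -1 *: (f - g) + (f - g').
  by rewrite scaleN1r opprB addrA subrK.
by rewrite {1}E dotL2_linear og ?og' ?mulr0 ?addr0//; exact: MB.
Qed.

Record Linfty := LinftyFun {
  Linfty_val :> circle R -> C;
  _ : Linfty_val \in cLfun +oo%E }.

Fact mulL2_subproof (phi : Linfty) (f : L2 R) : (fun z => phi z * f z) \in L2fun R.
Proof. by case: phi => phi phioo; apply: cLfun_mul_L2 => //; exact: L2_funP. Qed.

Definition mulL2 (phi : Linfty) (f : L2 R) : L2 R := L2_class (mulL2_subproof phi f).

(* [flip] is the unitary J : (J f)(z) = conj(z) f(conj(z)). *)
Fact flip_subproof (f : L2 R) :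
  (fun z : circle R => (z : C)^* * f (conj_circle z)) \in L2fun R.
Proof.
have /andP[f1 f2] := L2_funP f.
apply: (@cLfun_mul_L2 _ (fun z : circle R => (z : C)^*) (f \o @conj_circle R)); last first.
  by apply/andP; split; [exact: (Lfun_conj f1)|exact: (Lfun_conj f2)].
have := cLfun_monomial R (-1).
rewrite (_ : (fun z : circle R => (z : C) ^ (-1)) = (fun z : circle R => (z : C)^*))//.
by apply/funext => z; exact: (circle_inv z 1).
Qed.

Definition flip (f : L2 R) : L2 R := L2_class (flip_subproof f).
End L2_space.
Arguments hardy : clear implicits.
Arguments hardy_minus : clear implicits.

Section inner_functions.
Context (R : realType).
Local Notation m := (circle_measure R).
Local Notation C := R[i].

Definition radial (theta : C -> C) (z : circle R) : R -> C^o :=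
  fun r => theta (r%:C * (z : C)).

Definition boundary (theta : C -> C) (z : circle R) : C :=
  lim (radial theta z r @[r --> (1 : R)^'-]).

(* Analytic means complex differentiable at every point of the open disk.
   [boundary theta] is the radial boundary function; it carries information
   only where the radial limit exists, which is required almost everywhere. *)
Definition inner_function (theta : C -> C) : Prop :=
  [/\ forall z : C, `|z| < 1 -> derivable (theta : C^o -> C^o) z 1,
      exists M : R, forall z : C, `|z| < 1 -> `|theta z| <= M%:C &
      \forall z \ae m, cvg (radial theta z r @[r --> (1 : R)^'-]) /\
                       `|boundary theta z| = 1].

(* Values of theta outside the open disk are irrelevant throughout. *)
Definition nonconstant (theta : C -> C) : Prop :=
  ~ exists c : C, forall z : C, `|z| < 1 -> theta z = c.

(* theta H^2, where theta acts on L^2 through its boundary function. *)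
Definition mul_hardy (theta : C -> C) : set (L2 R) :=
  [set g | exists2 h, hardy R h & \forall z \ae m, g z = boundary theta z * h z].

(* K_theta is the orthogonal complement of theta H^2 in H^2; [model theta]
   below is the corresponding type. *)
Definition model_set (theta : C -> C) : set (L2 R) :=
  hardy R `&` orth (mul_hardy theta).

Section model.
Context (theta : C -> C).

Definition model_pred : {pred L2 R} := [pred f | `[< model_set theta f >]].

Lemma model_submod_closed : submod_closed model_pred.
Proof.
split.
  apply/asboolP; split=> [n _|g _].
    have := fourier_linear 1 (0 : L2 R) 0 n.
    by rewrite scaler0 addr0 mul1r => /eqP; rewrite -subr_eq0 opprD addNKr oppr_eq0 => /eqP.
  have := dotL2_linear 1 (0 : L2 R) 0 g.
  by rewrite scaler0 addr0 mul1r => /eqP; rewrite -subr_eq0 opprD addNKr oppr_eq0 => /eqP.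
move=> a f g /asboolP[f1 f2] /asboolP[g1 g2]; apply/asboolP; split => [n n0|h Sh].
  by rewrite fourier_linear f1// g1// mulr0 addr0.
by rewrite dotL2_linear f2// g2// mulr0 addr0.
Qed.

HB.instance Definition _ :=
  GRing.isSubmodClosed.Build C (L2 R) model_pred model_submod_closed.

Record model := Model { model_val :> L2 R; _ : model_val \in model_pred }.
HB.instance Definition _ := [isSub for model_val].
HB.instance Definition _ := [Choice of model by <:].
HB.instance Definition _ := [SubChoice_isSubLmodule of model by <:].

Definition bounded_operator (T : model -> model) : Prop :=
  linear T /\ exists M : R, forall f, normL2 (T f) <= M * normL2 f.

(* A = A_phi, i.e. A f = P_K (phi f) for every f in K = K_theta. *)
Definition is_toeplitz_of (phi : Linfty R) (A : model -> model) : Prop :=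
  forall f : model, is_orthoproj (model_set theta) (mulL2 phi f) (A f).

(* B = B_phi, i.e. B f = P_K J P_{H^2_-} (phi f) for every f in K;
   here g = P_{H^2_-} (phi f). *)
Definition is_hankel_of (phi : Linfty R) (B : model -> model) : Prop :=
  forall f : model, exists2 g : L2 R, is_orthoproj (hardy_minus R) (mulL2 phi f) g &
    is_orthoproj (model_set theta) (flip g) (B f).

Definition truncated_toeplitz : set (model -> model) :=
  [set A | exists phi, is_toeplitz_of phi A].

Definition truncated_hankel : set (model -> model) :=
  [set B | exists phi, is_hankel_of phi B].

Definition toeplitz_hankel : set (model -> model) :=
  truncated_toeplitz `&` truncated_hankel.

End model.
End inner_functions.
Arguments truncated_toeplitz {R} theta.
Arguments truncated_hankel {R} theta.
Arguments toeplitz_hankel {R} theta.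

(* Main.v *)
Require Import Defs.
From mathcomp Require Import all_boot all_order all_algebra.
From mathcomp Require Import complex.
From mathcomp Require Import all_classical all_reals all_analysis.
Import GRing.Theory.
Local Open Scope classical_set_scope.
Local Open Scope complex_scope.
Local Open Scope ring_scope.

(** The whole statement is linear algebra: it holds because the truncated
    Toeplitz operators and the truncated Hankel operators both form linear
    subspaces of the operators on the model space.  Given this, two
    decompositions [A + B = A' + B'] give [A - A' = B' - B], whose left side is
    Toeplitz and whose right side is Hankel; conversely, moving an element of
    the intersection from one summand to the other leaves each summand in its
    subspace.

    Both classes are subspaces because the operator with a given symbol depends
    linearly on that symbol: multiplication by the symbol, the flip [J], and
    the orthogonal projections are all linear ([mulL2_linear], [flip_linear],
    [is_orthoproj_linear]).  Projections enter as the relation [is_orthoproj],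
    so a projection of [a f + f'] is obtained by combining given projections of
    [f] and [f']. *)

Section linearity.
Context {R : realType}.
Local Notation C := R[i].

Fact Linfty_lin_subproof (a : C) (phi psi : Linfty R) :
  a *: (phi : circle R -> C) + (psi : circle R -> C) \in cLfun +oo%E.
Proof.
case: phi psi => [phi phioo] [psi psioo] /=.
have [_ lin] := @cLfun_submod_closed R +oo%E (leey _).
exact: lin.
Qed.

Definition Linfty_lin (a : C) (phi psi : Linfty R) : Linfty R :=
  LinftyFun (Linfty_lin_subproof a phi psi).

Lemma mulL2_linear (a : C) (phi psi : Linfty R) (f : L2 R) :
  mulL2 (Linfty_lin a phi psi) f = a *: mulL2 phi f + mulL2 psi f.
Proof.
apply: L2_ext.
have E0 := L2_classE (mulL2_subproof (Linfty_lin a phi psi) f).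
have E1 := L2_classE (mulL2_subproof phi f).
have E2 := L2_classE (mulL2_subproof psi f).
have E := L2_linE a (mulL2 phi f) (mulL2 psi f).
near=> z.
have -> : mulL2 (Linfty_lin a phi psi) f z = Linfty_lin a phi psi z * f z.
  by near: z.
have -> : L2_fun (a *: mulL2 phi f + mulL2 psi f) z
    = a * mulL2 phi f z + mulL2 psi f z by near: z.
have -> : mulL2 phi f z = phi z * f z by near: z.
have -> : mulL2 psi f z = psi z * f z by near: z.
by rewrite /= !fctE mulrDl mulrA.
Unshelve. all: by end_near. Qed.

(** The almost everywhere identity for [a *: f + g] may be used at [conj_circle z]
    because conjugation preserves null sets of the circle ([ae_conj_circle]). *)
Lemma flip_linear (a : C) (f g : L2 R) :
  flip (a *: f + g) = a *: flip f + flip g.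
Proof.
apply: L2_ext.
have E0 := L2_classE (flip_subproof (a *: f + g)).
have E1 := L2_classE (flip_subproof f).
have E2 := L2_classE (flip_subproof g).
have E := L2_linE a (flip f) (flip g).
have Ec := ae_conj_circle (L2_linE a f g).
near=> z.
have -> : flip (a *: f + g) z
    = (z : C)^* * L2_fun (a *: f + g) (conj_circle z) by near: z.
have -> : L2_fun (a *: f + g) (conj_circle z)
    = a * f (conj_circle z) + g (conj_circle z) by near: z.
have -> : L2_fun (a *: flip f + flip g) z = a * flip f z + flip g z by near: z.
have -> : flip f z = (z : C)^* * f (conj_circle z) by near: z.
have -> : flip g z = (z : C)^* * g (conj_circle z) by near: z.
by rewrite mulrDr mulrCA.
Unshelve. all: by end_near. Qed.

Lemma orth_linear (S : set (L2 R)) (a : C) (f g : L2 R) :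
  orth S f -> orth S g -> orth S (a *: f + g).
Proof. by move=> Sf Sg h Sh; rewrite dotL2_linear Sf// Sg// mulr0 addr0. Qed.

(** For a subspace [M], the pairs (vector, projection) form a subspace of
    [L2 * L2], as membership in [M] and orthogonality to [M] are both linear
    conditions. *)
Lemma is_orthoproj_linear (M : set (L2 R)) (a : C) (f f' g g' : L2 R) :
  (forall u v, M u -> M v -> M (a *: u + v)) ->
  is_orthoproj M f g -> is_orthoproj M f' g' ->
  is_orthoproj M (a *: f + f') (a *: g + g').
Proof.
move=> Mlin [Mg og] [Mg' og']; split; first exact: Mlin.
by rewrite opprD addrACA -scalerBr; exact: orth_linear.
Qed.

End linearity.

Section operator_spaces.
Context {R : realType} (theta : R[i] -> R[i]).
Implicit Types (a : R[i]) (A B : model theta -> model theta).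

Lemma model_set_linear a (u v : L2 R) :
  model_set theta u -> model_set theta v -> model_set theta (a *: u + v).
Proof.
have [_ lin] := @model_submod_closed R theta.
move=> Mu Mv; apply/asboolP.
by apply: (lin a u v); apply/asboolP.
Qed.

Lemma truncated_toeplitz_linear a A A' :
  truncated_toeplitz theta A -> truncated_toeplitz theta A' ->
  truncated_toeplitz theta (a *: A + A').
Proof.
move=> [phi Aphi] [psi Apsi]; exists (Linfty_lin a phi psi) => f.
rewrite mulL2_linear.
apply: is_orthoproj_linear (Aphi f) (Apsi f).
exact: model_set_linear.
Qed.

Lemma truncated_hankel_linear a B B' :
  truncated_hankel theta B -> truncated_hankel theta B' ->
  truncated_hankel theta (a *: B + B').
Proof.
move=> [phi Bphi] [psi Bpsi]; exists (Linfty_lin a phi psi) => f.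
have [g fg gB] := Bphi f; have [g' fg' gB'] := Bpsi f.
exists (a *: g + g').
  rewrite mulL2_linear; apply: is_orthoproj_linear fg fg'.
  exact: orth_linear.
rewrite flip_linear.
apply: is_orthoproj_linear gB gB'.
exact: model_set_linear.
Qed.

Lemma truncated_toeplitzD A A' :
  truncated_toeplitz theta A -> truncated_toeplitz theta A' ->
  truncated_toeplitz theta (A + A').
Proof. by rewrite -{2}[A]scale1r; exact: truncated_toeplitz_linear. Qed.

Lemma truncated_toeplitzB A A' :
  truncated_toeplitz theta A -> truncated_toeplitz theta A' ->
  truncated_toeplitz theta (A - A').
Proof.
by move=> TA TA'; rewrite addrC -scaleN1r; exact: truncated_toeplitz_linear.
Qed.

Lemma truncated_hankelB B B' :
  truncated_hankel theta B -> truncated_hankel theta B' ->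
  truncated_hankel theta (B - B').
Proof.
by move=> HB HB'; rewrite addrC -scaleN1r; exact: truncated_hankel_linear.
Qed.

End operator_spaces.

Theorem lemma5p7 (R : realType) (theta : R[i] -> R[i])
    (theta_inner : inner_function theta) (theta_nonconst : nonconstant theta)
    (T : model theta -> model theta) (T_bounded : bounded_operator T) :
  [/\
    (forall A A' B B' : model theta -> model theta,
       truncated_toeplitz theta A -> truncated_toeplitz theta A' ->
       truncated_hankel theta B -> truncated_hankel theta B' ->
       T = A + B -> T = A' + B' ->
       A - A' = B' - B /\ toeplitz_hankel theta (A - A')),
    (forall C A B : model theta -> model theta,
       toeplitz_hankel theta C ->
       truncated_toeplitz theta A -> truncated_hankel theta B -> T = A + B ->
       [/\ T = (A + C) + (B - C),
           truncated_toeplitz theta (A + C) &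
           truncated_hankel theta (B - C)]) &
    (forall A B : model theta -> model theta,
       truncated_toeplitz theta A -> truncated_hankel theta B -> T = A + B ->
       forall A' B' : model theta -> model theta,
         [/\ truncated_toeplitz theta A', truncated_hankel theta B' &
             T = A' + B'] <->
         exists2 C, toeplitz_hankel theta C & A' = A + C /\ B' = B - C)].
Proof.
have diff A A' B B' : truncated_toeplitz theta A ->
    truncated_toeplitz theta A' -> truncated_hankel theta B ->
    truncated_hankel theta B' -> T = A + B -> T = A' + B' ->
    A - A' = B' - B /\ toeplitz_hankel theta (A - A').
  move=> TA TA' HB HB' -> AB.
  have E : A - A' = B' - B.
    by apply/eqP; rewrite subr_eq addrAC -subr_eq opprK [B' + _]addrC AB.
  split=> //; split; first exact: truncated_toeplitzB.
  by rewrite E; exact: truncated_hankelB.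
have shift C A B : toeplitz_hankel theta C -> truncated_toeplitz theta A ->
    truncated_hankel theta B -> T = A + B ->
    [/\ T = (A + C) + (B - C), truncated_toeplitz theta (A + C) &
        truncated_hankel theta (B - C)].
  move=> [TC HC] TA HB ->; split.
  - by rewrite addrACA subrr addr0.
  - exact: truncated_toeplitzD.
  - exact: truncated_hankelB.
split=> // A B TA HB TE A' B'; split=> [[TA' HB' TE']|[C IC [-> ->]]].
  have [E IC] := diff _ _ _ _ TA' TA HB' HB TE' TE.
  exists (A' - A) => //; split; first by rewrite subrKC.
  by rewrite E subKr.
by have [? ? ?] := shift _ _ _ IC TA HB TE.
Qed.
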